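(* For every finite graph $H$, $$\mathrm{Hom}(H)\ \leq_{\mathrm P}^{\mathrm{Tur}}\ \mathrm{Ful\text{-}Rel}(H)\ \leq_{\mathrm P}^{\mathrm{Tur}}\ \mathrm{Sur\text{-}Hom}(H).$$
   Context: Graphs are finite and undirected, loops allowed. For a finite set $B$ and a relation $R\subseteq V_G\times B$ with full image (every $b\in B$ has some $v$ with $(v,b)\in R$), $G\ast R$ is the graph with vertex set $B$ and edge set $\{(a,b)\in B\times B: \exists (u,v)\in E_G,\ (u,a)\in R,\ (v,b)\in R\}$. $R$ has full domain if every $v\in V_G$ is related to some $b\in B$. A homomorphism $f:G\to H$ is surjective if it is surjective on vertices and every edge $(a,b)\in E_H$ equals $(f(u),f(v))$ for some $(u,v)\in E_G$. For a fixed graph $H$, each of the following decision problems takes as input a finite graph $G$. $\mathrm{Hom}(H)$: is there a homomorphism from $G$ to $H$? $\mathrm{Ful\text{-}Rel}(H)$: is there a relation $R\subseteq V_G\times V_H$ with full domain such that $G\ast R=H$? $\mathrm{Sur\text{-}Hom}(H)$: is there a surjective homomorphism from $G$ to $H$? $L\leq_{\mathrm P}^{\mathrm{Tur}}L'$ (polynomial-time reducibility) means there is a function $f$ computable in polynomial time such that for every input $x$: $x\in L$ if and only if $f(x)\in L'$. *)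

(* Defs.v *)
From HB Require Import structures.
From mathcomp Require Import all_boot all_order all_algebra.
Set Implicit Arguments.
Unset Strict Implicit.
Unset Printing Implicit Defensive.
Import GRing.Theory.

(* Undirected graphs with loops allowed and no multiple edges: [edge] is the   *)
(* characteristic function of a symmetric subset of V x V.                     *)
Record graph := Graph {
  vertex :> finType;
  edge : rel vertex;
  edge_sym : symmetric edge
}.

Section RelationProduct.
Variables (G : graph) (B : finType) (R : {set G * B}).

Definition full_domain := forall v : G, exists b : B, (v, b) \in R.
Definition full_image := forall b : B, exists v : G, (v, b) \in R.

Definition star_edge : rel B := fun a b =>
  [exists u : G, exists v : G,
     [&& edge u v, (u, a) \in R & (v, b) \in R]].

Lemma star_edge_sym : symmetric star_edge.
Proof.
move=> a b; apply/idP/idP => /existsP[u /existsP[v /and3P[Euv Ru Rv]]].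
  by apply/existsP; exists v; apply/existsP; exists u; rewrite edge_sym Euv Rv Ru.
by apply/existsP; exists v; apply/existsP; exists u; rewrite edge_sym Euv Rv Ru.
Qed.

(* The graph G * R.  It is considered only when R has full image; the users    *)
(* of [star] impose that condition separately.                                 *)
Definition star : graph := Graph star_edge_sym.

End RelationProduct.

Definition is_hom (G H : graph) (f : G -> H) :=
  forall u v : G, edge u v -> edge (f u) (f v).

Definition is_surjective_hom (G H : graph) (f : G -> H) :=
  [/\ is_hom f,
      forall b : H, exists v : G, f v = b
    & forall a b : H, edge a b ->
        exists u v : G, edge u v /\ (a, b) = (f u, f v)].

(* Deterministic Turing machines with [tm_tapes.+1] two-way infinite tapes.    *)
(* A cell holds either the blank [None], a letter of the input/output alphabet *)
(* S, or one of finitely many auxiliary letters.                               *)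
Inductive direction := MoveLeft | Stay | MoveRight.

Definition offset (d : direction) : int :=
  match d with MoveLeft => (-1)%R | Stay => 0%R | MoveRight => 1%R end.

Definition cell (S A : finType) := option (S + A)%type.

Record turing_machine (S : finType) := TuringMachine {
  tm_aux : finType;
  tm_state : finType;
  tm_tapes : nat;
  tm_start : tm_state;
  tm_halt : pred tm_state;
  tm_delta : tm_state -> {ffun 'I_tm_tapes.+1 -> cell S tm_aux} ->
             tm_state * ('I_tm_tapes.+1 -> cell S tm_aux * direction)
}.

Section Execution.
Variables (S : finType) (M : turing_machine S).

Record configuration := Configuration {
  state : tm_state M;
  head_pos : 'I_(tm_tapes M).+1 -> int;
  content : 'I_(tm_tapes M).+1 -> int -> cell S (tm_aux M)
}.

Definition scanned (c : configuration) :
    {ffun 'I_(tm_tapes M).+1 -> cell S (tm_aux M)} :=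
  [ffun i => content c i (head_pos c i)].

(* Halting configurations are fixed points of [step]. *)
Definition step (c : configuration) : configuration :=
  if tm_halt (state c) then c else
  let: (q, act) := tm_delta (state c) (scanned c) in
  Configuration q
    (fun i => (head_pos c i + offset (act i).2)%R)
    (fun i z => if z == head_pos c i then (act i).1 else content c i z).

(* The tape with w in cells 0, ..., size w - 1 and blanks elsewhere. *)
Definition word_tape (w : seq S) (z : int) : cell S (tm_aux M) :=
  match z with
  | Posz n => nth None [seq Some (inl s) | s <- w] n
  | Negz _ => None
  end.

Definition initial (w : seq S) : configuration :=
  Configuration (tm_start M) (fun _ => 0%R)
    (fun i => if i == ord0 then word_tape w else word_tape [::]).

(* Input on the first tape, output on the last one (they are the same tape if  *)
(* M has a single tape); the other tapes and all head positions are            *)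
(* unconstrained at the end of the computation.                                *)
Definition computes_within (t : nat) (w w' : seq S) :=
  let c := iter t step (initial w) in
  tm_halt (state c) /\ content c ord_max =1 word_tape w'.

End Execution.

(* A decision problem: the instances, how they are written as words over S,    *)
(* and which of them are yes-instances.                                        *)
Record problem (S : finType) := Problem {
  instance : Type;
  encode : instance -> seq S;
  yes : instance -> Prop
}.

Definition poly_time_computable (S : finType) (L L' : problem S)
    (f : instance L -> instance L') :=
  exists (M : turing_machine S) (p : {poly nat}),
    forall x : instance L,
      computes_within M p.[size (encode x)]%R (encode x) (encode (f x)).

Definition poly_reducible (S : finType) (L L' : problem S) :=
  exists2 f : instance L -> instance L',
    poly_time_computable f & forall x : instance L, yes x <-> yes (f x).

(* A graph is written as its adjacency matrix, row by row, in the order given  *)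
(* by [enum]: [Some b] is an entry, and [None] terminates a row.               *)
Definition graph_code (G : graph) : seq (option bool) :=
  flatten [seq rcons [seq Some (edge u v) | v <- enum G] None | u <- enum G].

Definition HomTo (H : graph) : problem (option bool) :=
  Problem graph_code (fun G => exists f : G -> H, is_hom f).

Definition FulRel (H : graph) : problem (option bool) :=
  Problem graph_code (fun G => exists R : {set G * H},
    [/\ full_domain R, full_image R & @edge (star R) =2 @edge H]).

Definition SurHom (H : graph) : problem (option bool) :=
  Problem graph_code (fun G => exists f : G -> H, is_surjective_hom f).

(* Main.v *)
Require Import Defs.
From mathcomp Require Import all_boot all_algebra zify.
Set Implicit Arguments.
Unset Strict Implicit.
Unset Printing Implicit Defensive.
Import GRing.Theory.

(* Hom(H) reduces to Ful-Rel(H) by G |-> G + H: a homomorphism together with   *)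
(* the identity of H gives R, and conversely any choice function of R is a     *)
(* homomorphism.  Ful-Rel(H) reduces to Sur-Hom(H) by replacing every vertex   *)
(* of G with twins, one for each image it may have under R.  Both adjacency    *)
(* matrices are produced in linear time by two-way transducers with            *)
(* append-only output, which two-tape Turing machines simulate with constant   *)
(* overhead.                                                                   *)

(** A relation [R] of full domain with [G * R = H] is a multivalued homomorphism: images of the two
    ends of an edge always form an edge of [H], and every edge of [H] arises so. A disjoint copy of
    [H] makes surjectivity free, so that only the existence of a homomorphism on [G] matters
    ([sum_graph_correct]). Splitting each vertex into [#|H|.+1] twins makes a multivalued map
    single-valued, and merging the twins goes back ([blowup_correct]).

    On adjacency matrices, the sum is block-diagonal and the blow-up replaces each entry with a
    constant square block ([adjacency_sum], [adjacency_blowup]). Since [H] is fixed, a bounded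
    number of passes over the input, or over each of its rows, writes these matrices
    ([append_rowsP], [duplicateP]); [transducer_poly_time] turns such a linear bound into a
    polynomial-time Turing machine. *)

Record transducer (S : finType) := Transducer {
  tr_state : finType;
  tr_start : tr_state;
  tr_halt : pred tr_state;
  tr_delta : tr_state -> option S -> tr_state * direction * seq S
}.

Section Transducer.
Variables (S : finType) (T : transducer S).

Definition cell_at (w : seq S) (z : int) : option S :=
  if z is Posz n then onth w n else None.

Definition tr_step (w : seq S) (c : tr_state T * int * seq S) :=
  let: (q, z, out) := c in
  if tr_halt q then c else
  let: (q', d, e) := tr_delta q (cell_at w z) in
  (q', (z + offset d)%R, out ++ e).

(** An upper bound on the number of steps, rather than their exact number, lets costs be rounded up
    and added. *)
Definition tr_reach w t c c' :=
  exists2 t', t' <= t & iter t' (tr_step w) c = c'.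

Lemma tr_reach_refl w t c : tr_reach w t c c.
Proof. by exists 0. Qed.

Lemma tr_reach_trans w c2 t1 t2 c1 c3 :
  tr_reach w t1 c1 c2 -> tr_reach w t2 c2 c3 -> tr_reach w (t1 + t2) c1 c3.
Proof.
move=> [s1 le1 <-] [s2 le2 <-]; exists (s2 + s1); last by rewrite iterD.
by rewrite addnC leq_add.
Qed.

Lemma tr_reach_leq w t1 t2 c1 c2 :
  t1 <= t2 -> tr_reach w t1 c1 c2 -> tr_reach w t2 c1 c2.
Proof. by move=> le12 [s les <-]; exists s => //; apply: leq_trans le12. Qed.

Lemma tr_reach_step w (q : tr_state T) z out q' d e :
  ~~ tr_halt q -> tr_delta q (cell_at w z) = (q', d, e) ->
  tr_reach w 1 (q, z, out) (q', (z + offset d)%R, out ++ e).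
Proof. by move=> /negbTE nh dE; exists 1 => //=; rewrite nh dE. Qed.

(** * Simulation of a transducer by a two-tape Turing machine *)

Definition max_emission :=
  \max_(x : tr_state T * option S) size (@tr_delta S T x.1 x.2).2.

Lemma size_emission (q : tr_state T) x : size (tr_delta q x).2 <= max_emission.
Proof. exact: (leq_bigmax (q, x)). Qed.

Definition letter_of (x : cell S void) : option S :=
  if x is Some (inl s) then Some s else None.

(* The letters still to be written are part of the state, so that each step    *)
(* writes at most one of them.                                                 *)
Definition tm_of_delta (s : tr_state T * max_emission.-bseq S)
    (x : {ffun 'I_2 -> cell S void}) :
    tr_state T * max_emission.-bseq S *
    ('I_2 -> cell S void * direction) :=
  if bseqval s.2 is a :: _ then
    ((s.1, insub_bseq max_emission (behead s.2)),
     fun i => if i == ord0 then (x ord0, Stay) else (Some (inl a), MoveRight))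
  else
    let: (q, d, e) := tr_delta s.1 (letter_of (x ord0)) in
    ((q, insub_bseq max_emission e),
     fun i => (x i, if i == ord0 then d else Stay)).

(** Halting also requires an empty buffer, for otherwise the last letters emitted would be lost. *)
Definition tm_of : turing_machine S :=
  TuringMachine (tr_start T, [bseq])
    (fun s => tr_halt s.1 && nilp s.2) tm_of_delta.

Lemma insub_bseqE n (s : seq S) : size s <= n -> insub_bseq n s = s :> seq S.
Proof. by move=> les; rewrite /insub_bseq /insubd insubT. Qed.

(** The simulation invariant: [e] is still to be written, the input tape is intact, and the output
    head stands just after [out]. *)
Definition tm_of_config (w : seq S) (q : tr_state T) (e : seq S) (z : int)
    (out : seq S) (c : configuration tm_of) :=
  [/\ (state c).1 = q, (state c).2 = e :> seq S,
      head_pos c ord0 = z /\ head_pos c ord_max = size out,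
      content c ord0 =1 word_tape tm_of w
    & content c ord_max =1 word_tape tm_of out].

Lemma word_tape_rcons w a z :
  word_tape tm_of (rcons w a) z =
  if z == size w then Some (inl a) else word_tape tm_of w z.
Proof.
case: z => [n|n] //=; rewrite map_rcons nth_rcons size_map eqz_nat.
by case: ltngtP => // ltn; rewrite nth_default ?size_map // ltnW.
Qed.

Lemma letter_word_tape w z : letter_of (word_tape tm_of w z) = cell_at w z.
Proof.
case: z => //= n; elim: w n => [|a w IH] [|n] //=.
Qed.

Lemma tm_of_emit w q e z out c :
  tm_of_config w q e z out c ->
  tm_of_config w q [::] z (out ++ e) (iter (size e) (@step _ tm_of) c).
Proof.
elim: e out c => [|a e IH] out c /=; first by rewrite cats0.
move=> cfg; rewrite -iterS iterSr -cat_rcons; apply: IH.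
case: cfg; case: c => -[q' s] hd tp /= -> sE [hd0 hd1] tp0 tp1.
(* The nonempty buffer alone prevents halting, whatever the transducer state. *)
rewrite /step /= andbC sE /= /tm_of_delta /= sE /=; split=> //=.
- by rewrite insub_bseqE //; move: (size_bseq s); rewrite sE /=; lia.
- by rewrite hd0 hd1 size_rcons; split; lia.
- by move=> z'; case: eqP => // ->; rewrite ffunE /= tp0.
- by move=> z'; rewrite hd1 word_tape_rcons tp1.
Qed.

(** One machine step moves the transducer and loads the buffer; at most [max_emission] further steps
    empty it. *)
Lemma tm_of_step w q z out c :
  tm_of_config w q [::] z out c ->
  let: (q', z', out') := tr_step w (q, z, out) in
  exists2 t, t <= max_emission.+1 &
    tm_of_config w q' [::] z' out' (iter t (@step _ tm_of) c).
Proof.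
move=> cfg; rewrite /tr_step; case: ifPn => [_|nhalt]; first by exists 0.
case dE: (tr_delta _ _) => [[q' d] e].
have lee : size e <= max_emission by rewrite -[e]/(q', d, e).2 -dE size_emission.
exists (size e).+1 => //; rewrite iterSr; apply: tm_of_emit.
case: cfg; case: c => -[q0 s] hd tp /= -> sE [hd0 hd1] tp0 tp1.
rewrite /step /= (negbTE nhalt) /= /tm_of_delta /= sE /= ffunE /=.
rewrite tp0 hd0 letter_word_tape dE; split=> //=.
- by rewrite insub_bseqE.
- by rewrite hd0 hd1 addr0.
- by move=> z'; case: eqP => // ->; rewrite ffunE /= tp0.
- by move=> z'; case: eqP => // ->; rewrite ffunE /= tp1.
Qed.

Lemma tm_of_reach w t q z out c q' z' out' :
  tr_reach w t (q, z, out) (q', z', out') ->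
  tm_of_config w q [::] z out c ->
  exists2 s, s <= t * max_emission.+1 &
    tm_of_config w q' [::] z' out' (iter s (@step _ tm_of) c).
Proof.
case=> t' let' it cfg.
suff [s les cfg'] : exists2 s, s <= t' * max_emission.+1 &
    tm_of_config w q' [::] z' out' (iter s (@step _ tm_of) c).
  by exists s => //; apply: leq_trans les _; rewrite leq_mul2r let' orbT.
elim: t' {let'} q' z' out' it => [|t' IH] q' z' out' /=.
  by case=> <- <- <-; exists 0.
case E: (iter _ _ _) => [[q1 z1] out1] it.
have [s les /tm_of_step] := IH _ _ _ E; rewrite it => -[s' les' cfg'].
by exists (s' + s); rewrite ?iterD // mulSn leq_add.
Qed.

End Transducer.

Lemma iter_step_halt (S : finType) (M : turing_machine S) t c :
  tm_halt (state c) -> iter t (@step _ M) c = c.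
Proof. by move=> hc; elim: t => //= t ->; rewrite /step hc. Qed.

Lemma transducer_poly_time (S : finType) (T : transducer S)
    (L L' : problem S) (f : instance L -> instance L') (A : nat) :
  (forall x, exists q z, tr_halt q /\
     tr_reach (encode x) (A * (size (encode x)).+1)
       (tr_start T, 0%R, [::]) (q, z, encode (f x))) ->
  poly_time_computable f.
Proof.
move=> fP; pose B := A * (max_emission T).+1.
exists (tm_of T), (B%:P * ('X + 1))%R => x.
have [q [z [hq rT]]] := fP x.
have [|s les] := tm_of_reach (c := initial (tm_of T) (encode x)) rT.
  by split=> //= -[].
set c := iter s _ _ => -[qE eE _ _ outE].
have hc : tm_halt (state c) by rewrite /= qE hq eE.
have leB : s <= (B%:P * ('X + 1)).[size (encode x)]%R.
  have -> : (B%:P * ('X + 1)).[size (encode x)]%R = B * (size (encode x)).+1.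
    by rewrite !hornerE -addn1.
  by rewrite /B mulnAC.
(* The machine may halt before the time bound; the halting configuration then stays fixed. *)
by rewrite /computes_within -(subnK leB) iterD -/c iter_step_halt.
Qed.

(** * Runs that scan a segment of the input in a single state *)

Section Scans.
Variables (S : finType) (T : transducer S).
Implicit Types (q : tr_state T) (w l s r : seq S).

Lemma cell_at_size l a r : cell_at (l ++ a :: r) (size l) = Some a.
Proof. by rewrite /= onth_cat ltnn subnn. Qed.

Lemma cell_at_end w : cell_at w (size w) = None.
Proof. by rewrite /= onth_default. Qed.

Lemma tr_reach_right q w l s r (emit : S -> seq S) out :
  w = l ++ s ++ r -> ~~ tr_halt q ->
  (forall a, a \in s -> tr_delta q (Some a) = (q, MoveRight, emit a)) ->
  tr_reach w (size s) (q, Posz (size l), out)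
    (q, Posz (size (l ++ s)), out ++ flatten [seq emit a | a <- s]).
Proof.
move=> -> nh; elim: s l out => [|a s IH] l out dE /=.
  by rewrite !cats0; apply: tr_reach_refl.
rewrite -[(size s).+1]/(1 + size s); apply: tr_reach_trans.
  apply: tr_reach_step => //; rewrite cell_at_size; apply: dE.
  exact: mem_head.
have -> : (Posz (size l) + offset MoveRight)%R = size (rcons l a).
  by rewrite size_rcons /=; lia.
rewrite -!cat_rcons [out ++ _ ++ _]catA; apply: IH => b sb.
by apply: dE; rewrite inE sb orbT.
Qed.

(** The run goes from the last cell of [s] to the cell just before [s], which is the blank cell -1
    when [l] is empty. *)
Lemma tr_reach_left q w l s r out :
  w = l ++ s ++ r -> ~~ tr_halt q ->
  (forall a, a \in s -> tr_delta q (Some a) = (q, MoveLeft, [::])) ->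
  tr_reach w (size s) (q, (Posz (size (l ++ s)) - 1)%R, out)
    (q, (Posz (size l) - 1)%R, out).
Proof.
move=> -> nh; elim/last_ind: s r => [|s a IH] r dE.
  by rewrite cats0; apply: tr_reach_refl.
rewrite size_rcons -[(size s).+1]/(1 + size s); apply: tr_reach_trans.
  have -> : (Posz (size (l ++ rcons s a)) - 1)%R = size (l ++ s).
    by rewrite !size_cat size_rcons; lia.
  apply: tr_reach_step => //; rewrite cat_rcons catA cell_at_size; apply: dE.
  by rewrite mem_rcons mem_head.
rewrite cats0 cat_rcons; apply: IH => b sb.
by apply: dE; rewrite mem_rcons inE sb orbT.
Qed.

End Scans.

(** * Writing a block-diagonal matrix *)

Definition matrix_code (rows : seq (seq bool)) : seq (option bool) :=
  flatten [seq rcons [seq Some b | b <- r] None | r <- rows].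

Lemma matrix_code_cat rows1 rows2 :
  matrix_code (rows1 ++ rows2) = matrix_code rows1 ++ matrix_code rows2.
Proof. by rewrite /matrix_code map_cat flatten_cat. Qed.

Lemma matrix_code_cons r rows :
  matrix_code (r :: rows) = [seq Some b | b <- r] ++ None :: matrix_code rows.
Proof. exact: cat_rcons. Qed.

Lemma matrix_code_rcons r rows :
  matrix_code (rcons rows r) = rcons (matrix_code rows ++ [seq Some b | b <- r]) None.
Proof. by rewrite -cats1 matrix_code_cat matrix_code_cons cats1 rcons_cat. Qed.

Section AppendRows.
Variables (m : nat) (hrows : seq (seq bool)).
Let N := size hrows.

(* [None] copies the input; [Some (true, j)] rewinds the input before writing  *)
(* the row of index j of hrows; [Some (false, j)] writes this row.             *)
Definition append_delta (q : option (bool * 'I_N.+1)) (x : option (option bool)) :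
    option (bool * 'I_N.+1) * direction * seq (option bool) :=
  match q, x with
  | None, Some (Some b) => (None, MoveRight, [:: Some b])
  | None, Some None => (None, MoveRight, rcons (nseq m (Some false)) None)
  | None, None => (Some (true, ord0), MoveLeft, [::])
  | Some (true, j), Some _ => (q, MoveLeft, [::])
  | Some (true, j), None => (Some (false, j), MoveRight, [::])
  | Some (false, j), Some (Some _) => (q, MoveRight, [:: Some false])
  | Some (false, j), _ =>
      (Some (true, inord j.+1), MoveLeft,
       rcons [seq Some b | b <- nth [::] hrows j] None)
  end.

(** The extra index [N] records that all rows of [hrows] are written. *)
Definition append_rows : transducer (option bool) :=
  @Transducer _ (option (bool * 'I_N.+1)) None
    (fun q => if q is Some (true, j) then j == N :> nat else false)
    append_delta.

Lemma append_rows_copy rows :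
  tr_reach (T := append_rows) (matrix_code rows) (size (matrix_code rows)).+1
    (None, 0%R, [::])
    (Some (true, inord 0), (Posz (size (matrix_code rows)) - 1)%R,
     matrix_code [seq r ++ nseq m false | r <- rows]).
Proof.
set w := matrix_code rows; rewrite -addn1.
pose emit (a : option bool) : seq (option bool) :=
  if a is Some b then [:: Some b] else rcons (nseq m (Some false)) None.
apply: tr_reach_trans.
  apply: (tr_reach_right (l := [::]) (s := w) (r := [::]) (emit := emit)) => //.
    by rewrite cats0.
  by case.
rewrite !cat0s; set out := flatten _.
have -> : matrix_code [seq r ++ nseq m false | r <- rows] = out ++ [::].
  rewrite cats0 /out /w; elim: rows {w out} => //= r rows IH.
  rewrite /matrix_code /= [in RHS]map_cat flatten_cat -IH; congr (_ ++ _).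
  rewrite map_rcons flatten_rcons map_cat map_nseq rcons_cat; congr (_ ++ _).
  by elim: r => //= b r <-.
rewrite (_ : inord 0 = ord0); last by apply: val_inj; rewrite /= inordK.
rewrite -[(- 1)%R]/(offset MoveLeft).
by apply: tr_reach_step => //; rewrite cell_at_end.
Qed.

(** The lower left zero block needs one [false] per column of the input; rereading the first input
    row supplies this count, which no finite state could store. *)
Lemma append_rows_pass rows j n out :
  let w := matrix_code rows in
  let n1 := size (head [::] rows) in
  j < N -> n <= size w ->
  n1 <= size w /\
  tr_reach (T := append_rows) w (2 * (size w).+1)
    (Some (true, inord j), (Posz n - 1)%R, out)
    (Some (true, inord j.+1), (Posz n1 - 1)%R,
     out ++ matrix_code [:: nseq n1 false ++ nth [::] hrows j]).
Proof.
move=> w n1 ltj len.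
have jE : @inord N j = j :> nat by rewrite inordK // ltnS ltnW.
(* The first row ends at its terminator, or at a blank if there are no rows. *)
have [r [wE endE]] : exists r, w = [seq Some b | b <- head [::] rows] ++ r /\
    (cell_at w n1 == None) || (cell_at w n1 == Some None).
  rewrite /n1 /w; case: rows {w n1 len} => [|r0 rows]; first by exists [::].
  exists (None :: matrix_code rows); rewrite matrix_code_cons; split=> //.
  by rewrite -(size_map Some (head _ _)) cell_at_size eqxx orbT.
have len1 : n1 <= size w by rewrite wE size_cat size_map leq_addr.
split=> //; rewrite mul2n -addnn; apply: tr_reach_trans.
  apply: (tr_reach_leq (t1 := n + 1)); first by rewrite addn1 ltnS.
  apply: tr_reach_trans.
    rewrite -{1}(size_takel len) -{2}(size_takel len).
    apply: (tr_reach_left (l := [::]) (r := drop n w)).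
    - by rewrite cat0s cat_take_drop.
    - by rewrite /= jE neq_ltn ltj.
    - by [].
  by apply: tr_reach_step; rewrite /= ?jE ?neq_ltn ?ltj.
rewrite cats0 /=.
apply: (tr_reach_leq (t1 := n1 + 1)); first by rewrite addn1 ltnS.
apply: tr_reach_trans.
  rewrite /n1 -(size_map Some) (_ : (0%Z - 1 + 1)%R = Posz (@size bool [::])) //.
  apply: (tr_reach_right (l := [::]) (emit := fun=> [:: Some false])) wE _ _ => //.
  by move=> _ /mapP[b _ ->].
have -> : matrix_code [:: nseq n1 false ++ nth [::] hrows j] =
    flatten [seq [:: Some false] | _ <- [seq Some b | b <- head [::] rows]] ++
    rcons [seq Some b | b <- nth [::] hrows j] None.
  rewrite /matrix_code /= cats0 map_cat rcons_cat map_nseq; congr (_ ++ _).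
  by rewrite /n1; elim: (head _ _) => //= b s <-.
rewrite cat0s size_map catA -[(- 1)%R]/(offset MoveLeft).
apply: tr_reach_step => //.
by case/orP: endE => /eqP -> /=; rewrite jE.
Qed.

Lemma append_rowsP rows (w := matrix_code rows) : exists q z, tr_halt q /\
  tr_reach (T := append_rows) w ((1 + N * 2) * (size w).+1)
    (tr_start append_rows, 0%R, [::])
    (q, z, matrix_code ([seq r ++ nseq m false | r <- rows] ++
             [seq nseq (size (head [::] rows)) false ++ h | h <- hrows])).
Proof.
(* One copying pass, then two scans of the input at most for each row of [hrows]. *)
suff passes j : j <= N -> exists n, n <= size w /\
    tr_reach (T := append_rows) w ((1 + j * 2) * (size w).+1)
    (tr_start append_rows, 0%R, [::])
    (Some (true, inord j), (Posz n - 1)%R,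
     matrix_code ([seq r ++ nseq m false | r <- rows] ++
       [seq nseq (size (head [::] rows)) false ++ h | h <- take j hrows])).
  have [n [_]] := passes N (leqnn N); rewrite take_size => rN.
  exists (Some (true, inord N)), (Posz n - 1)%R.
  by split=> //=; rewrite inordK.
elim: j => [|j IH] ltj.
  exists (size w); split=> //; rewrite mul1n take0 cats0.
  exact: append_rows_copy.
have [n [len rj]] := IH (ltnW ltj).
have [len1 r1] := append_rows_pass
  (matrix_code ([seq r ++ nseq m false | r <- rows] ++
       [seq nseq (size (head [::] rows)) false ++ h | h <- take j hrows]))
  ltj len.
exists (size (head [::] rows)); split=> //.
rewrite (take_nth [::]) // map_rcons -cats1 catA matrix_code_cat.
rewrite (_ : 1 + j.+1 * 2 = 1 + j * 2 + 2) ?mulnDl; last by lia.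
rewrite mulnDl in rj; exact: tr_reach_trans rj r1.
Qed.

End AppendRows.

Lemma rcons_nseq (A : Type) n (x : A) : rcons (nseq n x) x = nseq n.+1 x.
Proof. by elim: n => //= n ->. Qed.

(** * Repeating each matrix entry in a square block *)

Section Duplicate.
Variable k : nat.

(* [Some (false, a)] writes the copy of index a of the current row,            *)
(* [Some (true, a)] rewinds this row before doing so, and [None] halts.        *)
Definition dup_delta (q : option (bool * 'I_k.+1)) (x : option (option bool)) :
    option (bool * 'I_k.+1) * direction * seq (option bool) :=
  match q, x with
  | Some (false, a), Some (Some b) => (q, MoveRight, nseq k.+1 (Some b))
  | Some (false, a), Some None =>
      if a < k then (Some (true, inord a.+1), MoveLeft, [:: None])
      else (Some (false, ord0), MoveRight, [:: None])
  | Some (true, a), Some (Some _) => (q, MoveLeft, [::])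
  | Some (true, a), _ => (Some (false, a), MoveRight, [::])
  | _, _ => (None, Stay, [::])
  end.

Definition duplicate : transducer (option bool) :=
  @Transducer _ (option (bool * 'I_k.+1)) (Some (false, ord0))
    (fun q => q == None) dup_delta.

Definition dup_row (r : seq bool) := flatten [seq nseq k.+1 b | b <- r].

Lemma duplicate_scan w l r s a out : w = l ++ [seq Some b | b <- r] ++ s ->
  tr_reach (T := duplicate) w (size r) (Some (false, a), Posz (size l), out)
    (Some (false, a), Posz (size l + size r),
     out ++ [seq Some b | b <- dup_row r]).
Proof.
move=> wE; pose emit (x : option bool) : seq (option bool) := nseq k.+1 x.
rewrite -(size_map Some r) -size_cat.
have -> : [seq Some b | b <- dup_row r] =
    flatten [seq emit x | x <- [seq Some b | b <- r]].
  rewrite /dup_row map_flatten -!map_comp; congr flatten.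
  by apply: eq_map => b /=; rewrite map_nseq.
by apply: tr_reach_right wE _ _ => // _ /mapP[b _ ->].
Qed.

Lemma duplicate_row rows1 r rows2 out :
  let w := matrix_code (rows1 ++ r :: rows2) in
  tr_reach (T := duplicate) w (2 * k.+1 * (size r).+1)
    (Some (false, ord0), Posz (size (matrix_code rows1)), out)
    (Some (false, ord0), Posz (size (matrix_code (rcons rows1 r))),
     out ++ matrix_code (nseq k.+1 (dup_row r))).
Proof.
move=> w; set l := matrix_code rows1.
have wE : w = l ++ [seq Some b | b <- r] ++ (None :: matrix_code rows2).
  by rewrite /w matrix_code_cat matrix_code_cons.
have endE : cell_at w (Posz (size l + size r)) = Some None.
  by rewrite wE catA -(size_map Some r) -size_cat cell_at_size.
(* Rewinding stops at the blank cell -1 for the first row, and at the preceding terminator for the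
   others. *)
have startE : (cell_at w (Posz (size l) - 1)%R == None) ||
    (cell_at w (Posz (size l) - 1)%R == Some None).
  rewrite wE /l; case: (lastP rows1) => // rs r0.
  rewrite matrix_code_rcons.
  by rewrite size_rcons -addn1 PoszD addrK cat_rcons cell_at_size eqxx orbT.
(* The first [k] copies end with a rewind; the last one moves on to the next row and is treated
   apart. *)
suff copies a : a <= k -> tr_reach (T := duplicate) w (a * (2 * (size r).+1))
    (Some (false, ord0), Posz (size l), out)
    (Some (false, inord a), Posz (size l), out ++ matrix_code (nseq a (dup_row r))).
  apply: (tr_reach_leq (t1 := k * (2 * (size r).+1) + (size r + 1))); first by nia.
  apply: tr_reach_trans (copies k (leqnn k)) _.
  rewrite matrix_code_rcons size_rcons size_cat size_map -[(_ + size r).+1]addn1 PoszD.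
  rewrite -rcons_nseq matrix_code_rcons -cats1 !catA.
  apply: tr_reach_trans; first exact: duplicate_scan wE.
  rewrite -[Posz 1]/(offset MoveRight).
  by apply: tr_reach_step => //; rewrite endE /= inordK // ltnn.
elim: a => [|a IH] lea.
  rewrite cats0 (_ : inord 0 = ord0); first exact: tr_reach_refl.
  by apply: val_inj; rewrite /= inordK.
apply: (tr_reach_leq (t1 := a * (2 * (size r).+1) +
  (size r + (1 + (size r + 1))))); first by nia.
apply: tr_reach_trans (IH (ltnW lea)) _.
rewrite -rcons_nseq matrix_code_rcons -cats1 !catA.
apply: tr_reach_trans; first exact: duplicate_scan wE.
apply: tr_reach_trans.
  by apply: tr_reach_step => //; rewrite endE /= inordK ?lea // ltnS ltnW.
apply: tr_reach_trans.
  rewrite -(size_map Some r) -size_cat.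
  by apply: tr_reach_left wE _ _ => // _ /mapP[b _ ->].
rewrite -[X in tr_reach _ _ _ (_, X)]cats0.
have {2}-> : Posz (size l) = (Posz (size l) - 1 + offset MoveRight)%R.
  by rewrite /=; lia.
by apply: tr_reach_step => //; case/orP: startE => /eqP ->.
Qed.

Lemma duplicateP rows (w := matrix_code rows) : exists q z, tr_halt q /\
  tr_reach (T := duplicate) w (2 * k.+1 * (size w).+1)
    (tr_start duplicate, 0%R, [::])
    (q, z, matrix_code (flatten [seq nseq k.+1 (dup_row r) | r <- rows])).
Proof.
exists None, (Posz (size w) + offset Stay)%R; split=> //.
(* Each row costs time proportional to its own code, so the costs add up to a linear bound; one more
   step halts at the final blank. *)
suff rT rows1 rows2 : rows = rows1 ++ rows2 ->
    tr_reach (T := duplicate) w (2 * k.+1 * size (matrix_code rows1))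
      (tr_start duplicate, 0%R, [::])
      (Some (false, ord0), Posz (size (matrix_code rows1)),
       matrix_code (flatten [seq nseq k.+1 (dup_row r) | r <- rows1])).
  apply: (tr_reach_leq (t1 := 2 * k.+1 * size w + 1)); first by nia.
  apply: tr_reach_trans (rT rows [::] _) _; first by rewrite cats0.
  rewrite -[X in tr_reach _ _ _ (_, X)]cats0.
  by apply: tr_reach_step => //; rewrite cell_at_end.
elim/last_ind: rows1 rows2 => [|rows1 r IH] rows2 rowsE.
  exact: tr_reach_refl.
rewrite cat_rcons in rowsE.
rewrite map_rcons flatten_rcons matrix_code_cat.
rewrite {1}(_ : size (matrix_code (rcons rows1 r)) =
               size (matrix_code rows1) + (size r).+1); last first.
  by rewrite matrix_code_rcons size_rcons size_cat size_map addnS.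
rewrite mulnDr; apply: tr_reach_trans (IH _ rowsE) _.
by rewrite /w rowsE; apply: duplicate_row.
Qed.

End Duplicate.

(** * Adjacency matrices and the reduction by disjoint sum *)

Definition adjacency (G : graph) : seq (seq bool) :=
  [seq [seq edge u v | v <- enum G] | u <- enum G].

Lemma graph_codeE G : graph_code G = matrix_code (adjacency G).
Proof.
rewrite /graph_code /matrix_code /adjacency -map_comp; congr (flatten _).
by apply: eq_map => u /=; rewrite -map_comp.
Qed.

(** The default [[::]] gives the right count for the empty graph too. *)
Lemma size_head_adjacency G : size (head [::] (adjacency G)) = size (enum G).
Proof. by rewrite /adjacency; case E: (enum G) => //=; rewrite size_map. Qed.

Definition sum_edge (G H : graph) : rel (G + H)%type := fun x y =>
  match x, y with
  | inl u, inl v => edge u v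
  | inr u, inr v => edge u v
  | _, _ => false
  end.

Lemma sum_edge_sym G H : symmetric (@sum_edge G H).
Proof. by case=> u [] v //=; rewrite edge_sym. Qed.

Definition sum_graph (G H : graph) : graph := Graph (@sum_edge_sym G H).

Lemma map_const_nseq (A B : Type) (s : seq A) (b : B) :
  [seq b | _ <- s] = nseq (size s) b.
Proof. by elim: s => //= _ s ->. Qed.

Lemma enum_sum (A B : finType) :
  enum {: A + B} = [seq inl a | a <- enum A] ++ [seq inr b | b <- enum B].
Proof. by rewrite !enumT [in LHS]unlock. Qed.

Lemma enum_prod (A B : finType) :
  enum {: A * B} = [seq (a, b) | a <- enum A, b <- enum B].
Proof. by rewrite [in LHS]enumT [in LHS]unlock. Qed.

Lemma adjacency_sum G H : adjacency (sum_graph G H) =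
  [seq r ++ nseq #|H| false | r <- adjacency G] ++
  [seq nseq (size (head [::] (adjacency G))) false ++ h | h <- adjacency H].
Proof.
rewrite size_head_adjacency cardE /adjacency /= enum_sum.
move: (enum G) (enum H) => sG sH; rewrite map_cat -!map_comp.
congr (_ ++ _); apply: eq_map => u /=.
  by rewrite map_cat -!map_comp -(map_const_nseq sH).
by rewrite map_cat -!map_comp -(map_const_nseq sG).
Qed.

Lemma sum_graph_poly_time H :
  poly_time_computable
    ((fun G => sum_graph G H) : instance (HomTo H) -> instance (FulRel H)).
Proof.
apply: (@transducer_poly_time _ (append_rows #|H| (adjacency H))) => G /=.
rewrite !graph_codeE adjacency_sum; exact: append_rowsP.
Qed.

(** The copy of [H], related to [H] by the identity, provides full image and all edges. Conversely,
    any choice of one image per vertex sends edges to edges of [star R], so its restriction to [G]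
    is a homomorphism. *)
Lemma sum_graph_correct (G H : graph) :
  (exists f : G -> H, is_hom f) <->
  exists R : {set sum_graph G H * H},
    [/\ full_domain R, full_image R & @edge (star R) =2 @edge H].
Proof.
split=> [[f fhom] | [R [dom _ starE]]].
  pose g (x : sum_graph G H) : H := match x with inl u => f u | inr v => v end.
  exists [set x | g x.1 == x.2]; split.
  - by move=> x; exists (g x); rewrite inE.
  - by move=> b; exists (inr b); rewrite inE.
  move=> a b; apply/existsP/idP.
    case=> x /existsP[y]; rewrite !inE /= => /and3P[exy /eqP <- /eqP <-].
    by case: x y exy => [u|u] [v|v] //= /fhom.
  move=> eab; exists (inr a); apply/existsP; exists (inr b).
  by rewrite !inE /= eab !eqxx.
have [f fR] : exists f : sum_graph G H -> H, forall x, (x, f x) \in R.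
  by apply: (fin_all_exists (P := fun x b => (x, b) \in R)).
exists (f \o inl) => u v euv; rewrite /= -starE; apply/existsP; exists (inl u).
by apply/existsP; exists (inl v); rewrite !fR !andbT.
Qed.

(** * The reduction by twins *)

Definition blowup_edge (G : graph) (K : finType) : rel (G * K)%type :=
  fun x y => edge x.1 y.1.

Lemma blowup_edge_sym G K : symmetric (@blowup_edge G K).
Proof. by move=> x y; apply: edge_sym. Qed.

(** This is the categorical product of [G] with the complete graph with loops on [K]. *)
Definition blowup (G : graph) (K : finType) : graph :=
  Graph (@blowup_edge_sym G K).

Lemma map_allpairs_fst (A B C : Type) (f : A -> C) (s : seq A) (t : seq B) :
  [seq f x.1 | x <- [seq (a, b) | a <- s, b <- t]] =
  flatten [seq nseq (size t) (f a) | a <- s].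
Proof.
rewrite map_allpairs; congr (flatten _); apply: eq_map => a /=.
exact: map_const_nseq.
Qed.

(** [enum] lists pairs lexicographically, so twins are consecutive. *)
Lemma adjacency_blowup G (K : finType) k : #|K| = k.+1 ->
  adjacency (blowup G K) =
  flatten [seq nseq k.+1 (dup_row k r) | r <- adjacency G].
Proof.
move=> cK; rewrite /adjacency /= enum_prod -map_comp.
rewrite (map_allpairs_fst (fun u => [seq edge u x.1 | x <- _])) -cardE cK.
congr (flatten _); apply: eq_map => u; congr (nseq k.+1 _).
by rewrite (map_allpairs_fst (fun v => edge u v)) -cardE cK /dup_row -map_comp.
Qed.

Lemma blowup_poly_time H :
  poly_time_computable
    ((fun G => blowup G (option H)) : instance (FulRel H) -> instance (SurHom H)).
Proof.
apply: (@transducer_poly_time _ (duplicate #|H|)) => G /=.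
rewrite !graph_codeE (adjacency_blowup _ (card_option H)); exact: duplicateP.
Qed.

(* One copy per vertex of H lets f(v, -) reach all of R(v); the extra copy     *)
(* (v, None) keeps v visible when H is empty.                                  *)
Lemma blowup_correct (G H : graph) :
  (exists R : {set G * H},
    [/\ full_domain R, full_image R & @edge (star R) =2 @edge H]) <->
  exists f : blowup G (option H) -> H, is_surjective_hom f.
Proof.
split=> [[R [dom img starE]] | [f [fhom fv fe]]].
  have [c cR] : exists c : G -> H, forall v, (v, c v) \in R.
    by apply: (fin_all_exists (P := fun v b => (v, b) \in R)).
  pose f (x : blowup G (option H)) : H :=
    if x.2 is Some b then if (x.1, b) \in R then b else c x.1 else c x.1.
  have fR x : (x.1, f x) \in R by rewrite /f; case: x => v [b|] //=; case: ifP.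
  have fE v b : (v, b) \in R -> f (v, Some b) = b by rewrite /f /= => ->.
  exists f; split.
  - move=> x y exy; rewrite -starE; apply/existsP; exists x.1.
    by apply/existsP; exists y.1; rewrite !fR !andbT.
  - by move=> b; have [v vb] := img b; exists (v, Some b); apply: fE.
  - move=> a b; rewrite -starE => /existsP[u /existsP[v /and3P[euv ua vb]]].
    by exists (u, Some a), (v, Some b); split=> //; rewrite !fE.
exists [set x | [exists k, f (x.1, k) == x.2]]; split.
- by move=> v; exists (f (v, None)); rewrite inE; apply/existsP; exists None.
- move=> b; have [[v k] <-] := fv b; exists v; rewrite inE /=.
  by apply/existsP; exists k.
move=> a b; apply/existsP/idP => [[u /existsP[v]]|/fe[[u k] [[v l] [euv [-> ->]]]]].
  rewrite !inE /= => /and3P[euv /existsP[k /eqP <-] /existsP[l /eqP <-]].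
  (* Adjacency in the blow-up ignores the copy indices, so [k] and [l] may differ. *)
  exact: fhom.
exists u; apply/existsP; exists v; rewrite !inE /=; apply/and3P.
by split=> //; apply/existsP; [exists k | exists l].
Qed.

Theorem theorem4p5p1 (H : graph) :
  poly_reducible (HomTo H) (FulRel H) /\ poly_reducible (FulRel H) (SurHom H).
Proof.
split.
  exists (fun G => sum_graph G H) => [|G]; first exact: sum_graph_poly_time.
  exact: sum_graph_correct.
exists (fun G => blowup G (option H)) => [|G]; first exact: blowup_poly_time.
exact: blowup_correct.
Qed.
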